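(* In the setting described in the context, assume that all eigenvalues of $\overline A$ have negative real parts; that $\boldsymbol s=\overline{\boldsymbol s}$, $M=\overline M$ and $N=\overline N$ for all times (constant supply densities and compressor ratios); that $\overline\varphi_k>0$ for all $k\in\mathcal E$; and that $\overline{\boldsymbol\rho}_j>0$ for all $j\in\mathcal V_w$. Then there exist $\kappa_{\max}\in(0,1)$ (sufficiently small) and positive constants $a$ and $b$, independent of $t$ and $\kappa$, such that the following holds. Let $0<T\le\infty$ and $0\le\kappa\le\kappa_{\max}$. If the solution $(\boldsymbol\rho,\varphi)$ of the nonlinear system satisfies, for all $t\in[0,T)$, $$|\boldsymbol\rho_j(t)-\overline{\boldsymbol\rho}_j|\le\kappa\,\overline{\boldsymbol\rho}_j\ \ (j\in\mathcal V_w),\qquad |\varphi_k(t)-\overline\varphi_k|\le\kappa\,\overline\varphi_k\ \ (k\in\mathcal E),$$ then the error $\boldsymbol e=(\boldsymbol\rho,\varphi)-(\boldsymbol\rho_{\mathrm{lin}},\varphi_{\mathrm{lin}})$ between the solutions of the nonlinear and linearized systems satisfies, for all $t\in[0,T)$, $$\|\boldsymbol e(t)\|\le\left(\frac{a\kappa^2}{(1-\kappa)^2}+\frac{b\kappa^2}{1-\kappa}\right)\int_0^t\|e^{\overline A\tau}\|\,d\tau .$$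
   Context: Network. $(\mathcal E,\mathcal V)$ is a finite connected directed graph with edges $\mathcal E=\{1,\dots,E\}$ and nodes $\mathcal V=\{1,\dots,V\}$. The nodes are partitioned into a nonempty set of supply nodes $\mathcal V_s=\{1,\dots,V_s\}$ and a nonempty set of withdrawal nodes $\mathcal V_w=\{V_s+1,\dots,V\}$, with $V_w=V-V_s$ elements. We write $k:i\mapsto j$ if edge $k$ is directed from $i$ to $j$ ($i\neq j$). Every edge incident to a supply node is directed away from it (so the head of every edge is a withdrawal node). Every withdrawal node has at least one entering edge. Parameters and matrices. Each edge $k$ has length $\ell_k>0$, diameter $D_k>0$, friction factor $\lambda_k>0$, area $\chi_k=\pi D_k^2/4$; $\sigma>0$ is the sound speed. $L=\mathrm{diag}(\ell_k)$, $K=\mathrm{diag}(\lambda_k/(2D_k))$, $X=\mathrm{diag}(\chi_k)$ are $E\times E$. Each edge has a compressor ratio $\mu_k\ge1$ ($\mu_k=1$ for edges with no compressor). The $E\times V$ matrix $\Xi$ has $\Xi_{ki}=-\mu_k$ if edge $k$ leaves node $i$, $\Xi_{ki}=1$ if edge $k$ enters node $i$, and $0$ otherwise. $N$ ($E\times V_s$) and $M$ ($E\times V_w$) consist of the columns of $\Xi$ indexed by $\mathcal V_s$ and $\mathcal V_w$. $Q=\mathrm{sign}(M)$ componentwise, $Q_\ell$ is the positive part of $Q$, and $\Lambda=Q_\ell' X L Q_\ell$ ($'$ is transpose). Products $\odot$, ratios, absolute values and squares of vectors are componentwise. Bars denote constant nominal values: nominal densities $\overline{\boldsymbol\rho}\in\mathbb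 R^{V_w}$, nominal fluxes $\overline\varphi\in\mathbb R^E$, nominal supply densities $\overline{\boldsymbol s}\in\mathbb R^{V_s}$, and $\overline M,\overline N$ are the matrices $M,N$ for nominal compressor ratios. The nominal state $(\overline{\boldsymbol\rho},\overline\varphi)$ is not required to be a steady state. Nonlinear system (with $\boldsymbol s=\overline{\boldsymbol s}$, $M=\overline M$, $N=\overline N$), where $\boldsymbol w(t)\in\mathbb R^{V_w}$ is the given withdrawal: $$\dot{\boldsymbol\rho}=\Lambda^{-1}(Q'X\varphi-\boldsymbol w),\qquad \dot\varphi=-\sigma^2L^{-1}(\overline M\boldsymbol\rho+\overline N\overline{\boldsymbol s})-K\frac{\varphi\odot|\varphi|}{Q_\ell\boldsymbol\rho}.$$ Linearized system, with solution denoted $(\boldsymbol\rho_{\mathrm{lin}},\varphi_{\mathrm{lin}})$: $$\frac{d}{dt}\begin{bmatrix}\boldsymbol\rho_{\mathrm{lin}}\\ \varphi_{\mathrm{lin}}\end{bmatrix}=\overline A\begin{bmatrix}\boldsymbol\rho_{\mathrm{lin}}\\ \varphi_{\mathrm{lin}}\end{bmatrix}+\begin{bmatrix}-\Lambda^{-1}\boldsymbol w\\ -\sigma^2L^{-1}\overline N\overline{\boldsymbol s}-K\frac{\overline\varphi\odot|\overline\varphi|}{Q_\ell\overline{\boldsymbol\rho}}-\overline\alpha Q_\ell\overline{\boldsymbol\rho}+\overline\beta\,\overline\varphi\end{bmatrix},$$ $$\overline A=\begin{bmatrix}0&\Lambda^{-1}Q'X\\ \overline\alpha Q_\ell-\sigma^2L^{-1}\overline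 M&-\overline\beta\end{bmatrix},\quad \overline\alpha=K\,\mathrm{diag}\!\left(\frac{\overline\varphi\odot|\overline\varphi|}{Q_\ell\overline{\boldsymbol\rho}^2}\right),\quad \overline\beta=2K\,\mathrm{diag}\!\left(\frac{|\overline\varphi|}{Q_\ell\overline{\boldsymbol\rho}}\right).$$ Both solutions are defined on $[0,T)$ and start from the same initial state $(\boldsymbol\rho(0),\varphi(0))$, which is assumed to be a steady state of the nonlinear system for the initial values of the boundary and compressor data. Norms of vectors and matrices are the infinity norm and its induced matrix norm. *)

(* Defs.v *)
(* MathComp-Analysis *)
From mathcomp Require Import all_boot all_order all_algebra.
From mathcomp Require Import all_classical all_reals all_analysis.
From mathcomp Require Import complex.

Set Implicit Arguments.
Unset Strict Implicit.
Unset Printing Implicit Defensive.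

Import Order.TTheory GRing.Theory Num.Theory.
Import numFieldNormedType.Exports.

Local Open Scope classical_set_scope.
Local Open Scope ring_scope.

(* Nodes are 'I_(Vs + Vw), supply nodes first. Edges are labelled, so parallel
   edges are allowed. Connectedness ignores the direction of the edges: no edge
   enters a supply node, so strong connectedness is impossible. *)
Record network (Vs Vw E : nat) := Network {
  tail : 'I_E -> 'I_(Vs + Vw);
  head : 'I_E -> 'I_(Vs + Vw);
  supply_nonempty : (0 < Vs)%N;
  withdrawal_nonempty : (0 < Vw)%N;
  tail_neq_head : forall k, tail k != head k;
  head_not_supply : forall (k : 'I_E) (i : 'I_Vs), head k != lshift Vw i;
  withdrawal_entered : forall j : 'I_Vw, exists k, head k = rshift Vs j;
  net_connected : forall i j : 'I_(Vs + Vw),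
    connect (fun x y => [exists k, ((tail k == x) && (head k == y)) ||
                                   ((tail k == y) && (head k == x))]) i j
}.

Record pipes (R : realType) (E : nat) := Pipes {
  len : 'I_E -> R;
  diam : 'I_E -> R;
  fric : 'I_E -> R;
  sound : R;
  len_gt0 : forall k, 0 < len k;
  diam_gt0 : forall k, 0 < diam k;
  fric_gt0 : forall k, 0 < fric k;
  sound_gt0 : 0 < sound
}.

Section vectors.
Context {R : realType} {n : nat}.
Implicit Types x y : 'cV[R]_n.

Definition vmul x y : 'cV[R]_n := map2_mx (fun a b => a * b) x y.
Definition vdiv x y : 'cV[R]_n := map2_mx (fun a b => a / b) x y.
Definition vabs x : 'cV[R]_n := map_mx Num.norm x.
Definition vdiag x : 'M[R]_n := diag_mx x^T.

End vectors.

Section matrices.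
Context {R : realType}.

(* The library norm on column vectors is the maximum of the absolute values of
   the entries, i.e. the infinity norm; this is the matrix norm it induces. *)
Definition op_norm {m n : nat} (A : 'M[R]_(m, n)) : R :=
  sup [set `|A *m x| | x in [set x : 'cV[R]_n | `|x| <= 1]].

Definition expm {n : nat} (A : 'M[R]_n) : 'M[R]_n :=
  lim (series (fun k => (k`!%:R)^-1 *: A ^+ k) @ \oo).

Definition hurwitz {n : nat} (A : 'M[R]_n) : Prop :=
  forall z : R[i], eigenvalue (map_mx (real_complex R) A) z ->
    complex.Re z < 0.

End matrices.

(* x is differentiable on [0, T[ with derivative x'; at t = 0 the derivative is
   one-sided, and only the values of x on [0, T[ matter. *)
Definition derivative_on {R : realType} {V : normedModType R}
    (T : \bar R) (x x' : R -> V) : Prop :=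
  forall t : R, 0 <= t -> (t%:E < T)%E ->
    (u - t)^-1 *: (x u - x t)
      @[u --> within [set u | 0 <= u /\ (u%:E < T)%E] t^'] --> x' t.

Section model.
Context {R : realType} {Vs Vw E : nat}.
Variables (net : network Vs Vw E) (par : pipes R E) (mu : 'I_E -> R).

Definition Lmx : 'M[R]_E := vdiag (\col_k len par k).
Definition Kmx : 'M[R]_E := vdiag (\col_k (fric par k / (2 * diam par k))).
Definition Xmx : 'M[R]_E := vdiag (\col_k (pi * diam par k ^+ 2 / 4)).

Definition Ximx : 'M[R]_(E, Vs + Vw) :=
  \matrix_(k, i) (if i == tail net k then - mu k
                  else if i == head net k then 1 else 0).
Definition Nmx : 'M[R]_(E, Vs) := lsubmx Ximx.
Definition Mmx : 'M[R]_(E, Vw) := rsubmx Ximx.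
Definition Qmx : 'M[R]_(E, Vw) := map_mx Num.sg Mmx.
Definition Qlmx : 'M[R]_(E, Vw) := map_mx (fun q => Num.max q 0) Qmx.
Definition Lambda : 'M[R]_Vw := Qlmx^T *m Xmx *m Lmx *m Qlmx.

Section vector_fields.
Variables (s : 'cV[R]_Vs) (w : 'cV[R]_Vw).

Definition nl_rho (phi : 'cV[R]_E) : 'cV[R]_Vw :=
  invmx Lambda *m (Qmx^T *m Xmx *m phi - w).

Definition nl_phi (rho : 'cV[R]_Vw) (phi : 'cV[R]_E) : 'cV[R]_E :=
  - (sound par ^+ 2 *: (invmx Lmx *m (Mmx *m rho + Nmx *m s)))
  - Kmx *m vdiv (vmul phi (vabs phi)) (Qlmx *m rho).

Definition steady_state (rho : 'cV[R]_Vw) (phi : 'cV[R]_E) : Prop :=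
  nl_rho phi = 0 /\ nl_phi rho phi = 0.

(* The nominal state at which the system is linearized. *)
Variables (rhob : 'cV[R]_Vw) (phib : 'cV[R]_E).

Definition alphab : 'M[R]_E :=
  Kmx *m vdiag (vdiv (vmul phib (vabs phib)) (Qlmx *m vmul rhob rhob)).
Definition betab : 'M[R]_E :=
  2 *: Kmx *m vdiag (vdiv (vabs phib) (Qlmx *m rhob)).

Definition Abar : 'M[R]_(Vw + E) :=
  block_mx 0 (invmx Lambda *m Qmx^T *m Xmx)
           (alphab *m Qlmx - sound par ^+ 2 *: (invmx Lmx *m Mmx)) (- betab).

Definition lin_input : 'cV[R]_(Vw + E) :=
  col_mx (- (invmx Lambda *m w))
         (- (sound par ^+ 2 *: (invmx Lmx *m Nmx *m s))
          - Kmx *m vdiv (vmul phib (vabs phib)) (Qlmx *m rhob)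
          - alphab *m Qlmx *m rhob + betab *m phib).

End vector_fields.

Definition nonlinear_solution (s : 'cV[R]_Vs) (w : R -> 'cV[R]_Vw)
    (T : \bar R) (rho : R -> 'cV[R]_Vw) (phi : R -> 'cV[R]_E) : Prop :=
  derivative_on T rho (fun t => nl_rho (w t) (phi t)) /\
  derivative_on T phi (fun t => nl_phi s (rho t) (phi t)).

Definition linear_solution (s : 'cV[R]_Vs) (w : R -> 'cV[R]_Vw)
    (rhob : 'cV[R]_Vw) (phib : 'cV[R]_E)
    (T : \bar R) (rho : R -> 'cV[R]_Vw) (phi : R -> 'cV[R]_E) : Prop :=
  derivative_on T (fun t => col_mx (rho t) (phi t))
    (fun t => Abar rhob phib *m col_mx (rho t) (phi t)
              + lin_input s (w t) rhob phib).

End model.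

(* Main.v *)
Require Import Defs.
From mathcomp Require Import all_boot all_order all_algebra.
From mathcomp Require Import all_classical all_reals all_analysis.
From mathcomp Require Import ring lra.

Set Implicit Arguments.
Unset Strict Implicit.
Unset Printing Implicit Defensive.

Import Order.TTheory GRing.Theory Num.Theory.
Import numFieldNormedType.Exports.
Local Open Scope classical_set_scope.
Local Open Scope ring_scope.

(* The withdrawal cancels in the error equation, which is e' = A e + f with
   e(0) = 0, where f is the linearization remainder at the nonlinear solution.
   Its density block vanishes, and its entry on an edge with flux p, head
   density r and nominal values p0, r0 is, up to the sign and the friction
   coefficient, the square (p - p0 r / r0)^2 / r, which is at most
   4 (p0^2 / r0) kappa^2 / (1 - kappa). This gives the b-term alone, so any
   a > 0 will do. Duhamel's formula is replaced by a monotonicity argument: the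
   derivative of exp((t - s) A) e(s) in s is exp((t - s) A) f(s), so no
   vector-valued integral is needed. *)

(** * Matrix norms and the matrix exponential *)

Section matrix_norm.
Context {R : realType}.

Lemma mx_norm_entry m n (A : 'M[R]_(m, n)) i j : `|A i j| <= `|A|.
Proof.
rewrite [leRHS]/Num.norm /= mx_normrE.
exact: (le_bigmax _ (fun ij : 'I_m * 'I_n => `|A ij.1 ij.2|) (i, j)).
Qed.

Lemma mx_norm_le m n (A : 'M[R]_(m, n)) c :
  0 <= c -> (forall i j, `|A i j| <= c) -> `|A| <= c.
Proof.
move=> c0 Ac; rewrite [leLHS]/Num.norm /= mx_normrE.
by apply/bigmax_leP; split => // -[i j] _; exact: Ac.
Qed.

(** The library norm of a matrix is its largest entry in absolute value, which is not
    submultiplicative; the inner dimension [n] pays for the sum of [n] products. *)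
Lemma mulmx_norm m n p (A : 'M[R]_(m, n)) (B : 'M[R]_(n, p)) :
  `|A *m B| <= n%:R * `|A| * `|B|.
Proof.
apply: mx_norm_le => [|i j]; first by rewrite !mulr_ge0.
rewrite mxE (le_trans (ler_norm_sum _ _ _))//.
have -> : n%:R * `|A| * `|B| = \sum_(k < n) `|A| * `|B|.
  by rewrite sumr_const card_ord -mulrA mulr_natl.
rewrite ler_sum// => k _.
by rewrite normrM ler_pM// mx_norm_entry.
Qed.

(** The value of [sup] carries information only for a nonempty set that is bounded above. *)
Lemma op_norm_has_sup m n (A : 'M[R]_(m, n)) :
  has_sup [set `|A *m x| | x in [set x : 'cV[R]_n | `|x| <= 1]].
Proof.
split; first by exists `|A *m (0 : 'cV_n)|; exists 0 => //=; rewrite normr0.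
exists (n%:R * `|A|) => _ [x /= x1 <-].
by rewrite (le_trans (mulmx_norm _ _))// ler_piMr// mulr_ge0.
Qed.

Lemma op_norm_ge0 m n (A : 'M[R]_(m, n)) : 0 <= op_norm A.
Proof.
have -> : 0 = `|A *m (0 : 'cV_n)| by rewrite mulmx0 normr0.
apply: sup_upper_bound; first exact: op_norm_has_sup.
by exists 0 => //=; rewrite normr0.
Qed.

Lemma op_normP m n (A : 'M[R]_(m, n)) (x : 'cV[R]_n) :
  `|A *m x| <= op_norm A * `|x|.
Proof.
have [->|x0] := eqVneq x 0; first by rewrite mulmx0 !normr0 mulr0.
have nx0 : 0 < `|x| by rewrite normr_gt0.
rewrite -ler_pdivrMr//.
have -> : `|A *m x| / `|x| = `|A *m (`|x|^-1 *: x)|.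
  by rewrite -scalemxAr normrZ normfV normr_id mulrC.
apply: sup_upper_bound; first exact: op_norm_has_sup.
by exists (`|x|^-1 *: x) => //=; rewrite normrZ normfV normr_id mulVf// gt_eqF.
Qed.

(** Write C = (C - D) + D on the unit ball. The resulting continuity makes the integrand of the
    error bound continuous, so that it is integrable and the fundamental theorem of calculus
    applies. *)
Lemma op_norm_lipschitz m n (A B : 'M[R]_(m, n)) :
  `|op_norm A - op_norm B| <= n%:R * `|A - B|.
Proof.
suff h (C D : 'M[R]_(m, n)) : op_norm C <= op_norm D + n%:R * `|C - D|.
  rewrite ler_norml; apply/andP; split; last by rewrite lerBlDl h.
  by rewrite lerBrDr addrC lerBlDr distrC h.
apply: ge_sup; first by have [] := op_norm_has_sup C.
move=> _ [x /= x1 <-].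
rewrite -[C in C *m x](subrK D) addrC mulmxDl (le_trans (ler_normD _ _))//.
apply: lerD.
  by rewrite (le_trans (op_normP _ _))// ler_piMr// op_norm_ge0.
by rewrite (le_trans (mulmx_norm _ _))// ler_piMr// mulr_ge0.
Qed.

Lemma op_norm_continuous m n : continuous (@op_norm R m n).
Proof.
move=> A; apply/(@cvgrPdist_le _ _ _ (nbhs A)) => eps eps0.
(* The Lipschitz constant [n] may be zero, so division is by [n + 1]. *)
have n0 : 0 < n%:R + 1 :> R by rewrite ltr_wpDl.
have : B @[B --> A] --> A by exact: cvg_id.
move/cvgrPdist_le => /(_ _ (divr_gt0 eps0 n0)); apply: filterS => B AB.
apply: (le_trans (op_norm_lipschitz A B)).
apply: (@le_trans _ _ ((n%:R + 1) * `|A - B|)).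
  by rewrite ler_wpM2r// lerDl.
by rewrite mulrC -ler_pdivlMr.
Qed.

Lemma cvg_mx (T : Type) (F : set_system T) (FF : Filter F) m n
    (u : T -> 'M[R]_(m, n)) (l : 'M[R]_(m, n)) :
  (forall i j, u x i j @[x --> F] --> l i j) -> u @ F --> l.
Proof.
move=> ul; apply/cvgrPdist_le => eps eps0.
suff : \forall x \near F, forall i j, `|l i j - u x i j| <= eps.
  apply: filterS => x h; apply: mx_norm_le => [|i j]; first exact: ltW.
  by rewrite !mxE.
apply: filter_forall => i; apply: filter_forall => j.
by have /cvgrPdist_le/(_ _ eps0) := ul i j.
Qed.

End matrix_norm.

(** * Entries of the matrix exponential as scalar power series *)

Section expm.
Context {R : realType} {n : nat}.
Variable A : 'M[R]_n.

Let c i j := fun k : nat => (k`!%:R)^-1 * (A ^+ k) i j.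

Lemma mx_norm_exp k : `|A ^+ k| <= (n%:R * `|A|) ^+ k.
Proof.
elim: k => [|k ih].
  rewrite !expr0; apply: mx_norm_le => // i j.
  by rewrite mxE; case: eqP => _; rewrite ?normr1 ?normr0.
rewrite exprS (le_trans (mulmx_norm _ _))// exprS ler_wpM2l//.
Qed.

(** Domination by the scalar exponential series at n |A| |x|. *)
Let cvg_c i j x : cvgn (pseries (c i j) x).
Proof.
apply: normed_cvg.
have := is_cvg_series_exp_coeff (n%:R * `|A| * `|x|).
apply: series_le_cvg => //= k.
  by rewrite /exp_coeff /= divr_ge0// exprn_ge0// !mulr_ge0.
rewrite /exp_coeff /c/= !normrM normrX normfV normr_nat exprMn.
rewrite [leRHS]mulrC mulrA ler_wpM2r ?exprn_ge0//.
by rewrite ler_wpM2l ?invr_ge0// (le_trans (mx_norm_entry _ _ _))// mx_norm_exp.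
Qed.

(** Since (k+1)/(k+1)! = 1/k! and A^(k+1) = A^k A, formal differentiation is multiplication by [A]
    on the right. Convergence of the differentiated series thus reduces to finite combinations of
    convergent ones. *)
Let diffs_c i j : pseries_diffs (c i j) = fun k => \sum_l c i l k * A l j.
Proof.
apply/funext => k; rewrite /pseries_diffs /c factS natrM invfM mulrA mulVKf//.
rewrite exprSr mxE mulr_sumr; by apply: eq_bigr => l _; rewrite mulrA.
Qed.

Let pseries_sum (d : 'I_n -> R^nat) (a : 'I_n -> R) x :
  pseries (fun k => \sum_l d l k * a l) x =
  fun N => \sum_l pseries (d l) x N * a l.
Proof.
apply/funext => N; rewrite /pseries /series /=.
under [RHS]eq_bigr do rewrite mulr_suml.
rewrite exchange_big; apply: eq_bigr => k _ /=.
by rewrite mulr_suml; apply: eq_bigr => l _; rewrite mulrAC.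
Qed.

Let cvg_sum (d : 'I_n -> R^nat) (a : 'I_n -> R) x :
  (forall l, cvgn (pseries (d l) x)) ->
  pseries (fun k => \sum_l d l k * a l) x @ \oo
    --> \sum_l limn (pseries (d l) x) * a l.
Proof.
move=> dx; rewrite pseries_sum.
apply: cvg_big => [|l _]; first exact: add_continuous.
by apply: cvgMr_tmp; exact: dx.
Qed.

Let is_cvg_diffs i j x : cvgn (pseries (pseries_diffs (c i j)) x).
Proof. by rewrite diffs_c; apply/cvg_ex; eexists; apply: cvg_sum. Qed.

(** Term-by-term differentiation by [pseries_snd_diffs] also asks for convergence of the second
    formal derivative. *)
Let is_cvg_diffs2 i j x :
  cvgn (pseries (pseries_diffs (pseries_diffs (c i j))) x).
Proof.
have -> : pseries_diffs (pseries_diffs (c i j)) =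
    fun k => \sum_l pseries_diffs (c i l) k * A l j.
  apply/funext => k; rewrite diffs_c /pseries_diffs mulr_sumr.
  by apply: eq_bigr => l _; rewrite mulrA.
by apply/cvg_ex; eexists; apply: cvg_sum.
Qed.

Lemma mx_exprZn x k : (x *: A) ^+ k = x ^+ k *: A ^+ k.
Proof.
elim: k => [|k ih]; first by rewrite !expr0 scale1r.
rewrite !exprS ih; apply/matrixP => i j; rewrite !mxE mulr_sumr.
by apply: eq_bigr => l _; rewrite !mxE mulrACA.
Qed.

Lemma expmE i j x : expm (x *: A) i j = limn (pseries (c i j) x).
Proof.
suff : series (fun k => (k`!%:R)^-1 *: (x *: A) ^+ k) @ \oo -->
    \matrix_(i, j) limn (pseries (c i j) x).
  by rewrite /expm => /cvg_lim ->//; rewrite mxE.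
apply: cvg_mx => i' j'; rewrite mxE.
suff -> : (fun N => series (fun k => (k`!%:R)^-1 *: (x *: A) ^+ k) N i' j') =
  pseries (c i' j') x by exact: cvg_c.
apply/funext => N; rewrite /pseries /series /= summxE.
by apply: eq_bigr => k _; rewrite mx_exprZn scalerA mxE /c mulrAC.
Qed.

Lemma is_derive_expm i j (x : R) :
  is_derive x 1 (fun y => expm (y *: A) i j) ((expm (x *: A) *m A) i j).
Proof.
have -> : (fun y => expm (y *: A) i j) = fun y => limn (pseries (c i j) y).
  by apply/funext => y; rewrite expmE.
apply: is_derive_eq.
  (* Convergence is required at some point of modulus larger than |x|; the series converge
     everywhere, so |x| + 1 serves. *)
  apply: (@pseries_snd_diffs _ _ (`|x| + 1)) => //.
  by rewrite [ltRHS]ger0_norm ?addr_ge0// ltrDl.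
rewrite diffs_c mxE; under eq_bigr do rewrite expmE.
by apply/cvg_lim => //; apply: cvg_sum.
Qed.

Lemma expm0 : expm ((0 : R) *: A) = 1%:M.
Proof.
apply/matrixP => i j; rewrite expmE.
suff -> : limn (pseries (c i j) 0) = c i j 0 by rewrite /c fact0 invr1 mul1r.
apply/lim_near_cst => //.
(* The partial sum of index 0 is empty; from index 1 on, only the constant term survives at 0. *)
exists 1%N => // -[//|N] _; rewrite /pseries /series /= big_nat_recl//.
rewrite big1 ?addr0 ?expr0 ?mulr1//.
by move=> k _; rewrite exprS mul0r mulr0.
Qed.

Lemma expm_continuous : continuous (fun x : R => expm (x *: A)).
Proof.
move=> x; apply: cvg_mx => i j.
have [dx _] := is_derive_expm i j x.
exact/differentiable_continuous/derivable1_diffP.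
Qed.

End expm.

(** * Error bound for a perturbed linear system *)

Section derivative_on.
Context {R : realType}.
Variable T : \bar R.

Lemma derivative_onB (V : normedModType R) (x y x' y' : R -> V) :
  derivative_on T x x' -> derivative_on T y y' ->
  derivative_on T (fun t => x t - y t) (fun t => x' t - y' t).
Proof.
move=> dx dy t t0 tT.
have -> : (fun u => (u - t)^-1 *: (x u - y u - (x t - y t))) =
    (fun u => (u - t)^-1 *: (x u - x t)) \-
    (fun u => (u - t)^-1 *: (y u - y t)).
  apply/funext => u; rewrite /= -scalerBr !opprB addrACA [in RHS]addrACA.
  by rewrite [- y u + _]addrC.
exact: cvgB (dx t t0 tT) (dy t t0 tT).
Qed.

Lemma derivative_on_entry m n (x x' : R -> 'M[R]_(m, n)) i j :
  derivative_on T x x' ->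
  derivative_on T (fun t => x t i j) (fun t => x' t i j).
Proof.
move=> dx t t0 tT.
have -> : (fun u => (u - t)^-1 *: (x u i j - x t i j)) =
    (fun M : 'M[R]_(m, n) => M i j) \o (fun u => (u - t)^-1 *: (x u - x t)).
  by apply/funext => u; rewrite /= !mxE.
apply: cvg_comp; first exact: (dx t t0 tT).
exact: coord_continuous.
Qed.

(** The nonlinear system is given block by block and the linearized one as a stacked vector; scalar
    entries are the common form in which the two are subtracted. *)
Lemma derivative_on_col_mx_entry m n
    (x x' : R -> 'cV[R]_m) (y y' : R -> 'cV[R]_n) i j :
  derivative_on T x x' -> derivative_on T y y' ->
  derivative_on T (fun t => col_mx (x t) (y t) i j)
                  (fun t => col_mx (x' t) (y' t) i j).
Proof.
move=> dx dy.
have colu (a : R -> 'cV[R]_m) (b : R -> 'cV[R]_n) k :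
    (fun t => col_mx (a t) (b t) (lshift n k) j) = (fun t => a t k j).
  by apply/funext => t; rewrite col_mxEu.
have cold (a : R -> 'cV[R]_m) (b : R -> 'cV[R]_n) k :
    (fun t => col_mx (a t) (b t) (rshift m k) j) = (fun t => b t k j).
  by apply/funext => t; rewrite col_mxEd.
case: (split_ordP i) => k ->.
  by rewrite !colu; exact: derivative_on_entry.
by rewrite !cold; exact: derivative_on_entry.
Qed.

Lemma near_lt_ereal (t : R) : (t%:E < T)%E -> \forall u \near t, (u%:E < T)%E.
Proof.
case: T => [r| |]; last by [].
  rewrite lte_fin => tr.
  by apply: filterS (lt_nbhsl tr) => u ur; rewrite lte_fin.
by move=> _; apply: filterE => u; exact: ltry.
Qed.

(** At an interior time the constraint 0 <= u < T holds in a whole neighbourhood, so the one-sided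
    notion becomes the usual derivative. The Caratheodory slope function is the difference quotient,
    completed by [x' t] at [t]. *)
Lemma derivative_on_is_derive (x x' : R -> R) t :
  derivative_on T x x' -> 0 < t -> (t%:E < T)%E -> is_derive t 1 x (x' t).
Proof.
move=> dx t0 tT; apply/is_derive1_caratheodory.
exists (fun z => if z == t then x' t else (z - t)^-1 *: (x z - x t)); split.
- move=> z; case: eqP => [->|/eqP zt]; first by rewrite !subrr mulr0.
  by rewrite /GRing.scale /= mulrAC mulVf ?mul1r// subr_eq0.
- apply/continuous_withinNx; rewrite eqxx.
  have := dx t (ltW t0) tT; apply: cvg_trans => P /=.
  rewrite !nbhs_simpl /= => tP.
  have {}tP : \forall u \near t^', 0 <= u /\ (u%:E < T)%E ->
    P ((u - t)^-1 *: (x u - x t)) by exact: tP.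
  near=> u; rewrite /preimage/=.
  have /negPf -> : u != t by near: u; exact: nbhs_dnbhs_neq.
  have : 0 <= u /\ (u%:E < T)%E.
    split; near: u; apply: nbhs_dnbhs; last exact: near_lt_ereal.
    by apply: filterS (lt_nbhsr t0) => v /ltW.
  by near: u.
- by rewrite eqxx.
Unshelve. all: by end_near. Qed.

(** Values at negative times are arbitrary, so only right continuity can hold at 0. It comes from
    x(u) = x(0) + u q(u), where the difference quotient q converges. *)
Lemma derivative_on_cvg_at_right0 (x x' : R -> R) :
  derivative_on T x x' -> (0 < T)%E -> x u @[u --> 0^'+] --> x 0.
Proof.
move=> dx T0.
have dx0 : u^-1 * (x u - x 0) @[u --> 0^'+] --> x' 0.
  have := dx 0 (lexx _) T0; apply: cvg_trans => P /=.
  rewrite !nbhs_simpl /= => tP.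
  have {}tP : \forall u \near 0^', 0 <= u /\ (u%:E < T)%E ->
    P ((u - 0)^-1 *: (x u - x 0)) by exact: tP.
  have {}tP : \forall u \near 0, u != 0 -> 0 <= u /\ (u%:E < T)%E ->
    P ((u - 0)^-1 *: (x u - x 0)) by exact: tP.
  near=> u.
  have u0 : 0 < u by near: u; exact: nbhs_right_gt.
  have : u != 0 by rewrite gt_eqF.
  have : 0 <= u /\ (u%:E < T)%E.
    split; [exact: ltW|near: u; apply: cvg_within; exact: near_lt_ereal].
  rewrite /preimage/= (_ : u^-1 * _ = (u - 0)^-1 *: (x u - x 0)); last first.
    by rewrite subr0.
  move=> uT un0; move: un0 uT; near: u.
  by apply: cvg_within.
have : x 0 + u * (u^-1 * (x u - x 0)) @[u --> 0^'+] --> x 0 + 0 * x' 0.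
  apply: cvgD; first exact: cvg_cst.
  by apply: cvgM => //; apply: cvg_within.
rewrite mul0r addr0; apply: cvg_trans; apply: near_eq_cvg; near=> u.
rewrite mulrA mulfV ?mul1r ?subrKC//.
Unshelve. all: by end_near. Qed.

End derivative_on.

(** * The variation-of-constants estimate *)

Section duhamel.
Context {R : realType} {n : nat}.
Variable A : 'M[R]_n.

Let h (x : R) := op_norm (expm (x *: A)).

Let h_continuous : continuous h.
Proof.
move=> x; apply: (cvg_comp (fun x : R => expm (x *: A)) op_norm).
  exact: expm_continuous.
exact: op_norm_continuous.
Qed.

Let G (x : R) := \int[lebesgue_measure]_(tau in `[0, x]) h tau.

Let h_integrable (a b : R) : lebesgue_measure.-integrable `[a, b] (EFin \o h).
Proof.
apply: continuous_compact_integrable; first exact: segment_compact.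
by apply: continuous_subspaceT => x; exact: h_continuous.
Qed.

Let is_derive_G (x : R) : 0 < x -> is_derive x 1 G (h x).
Proof.
move=> x0.
have [] := @continuous_FTC1_closed R h 0 x (x + 1) _
  (h_integrable 0 (x + 1)) x0 (@h_continuous x).
  by rewrite ltrDl.
by move=> dG G'; apply: DeriveDef => //; rewrite -derive1E.
Qed.

Let G0 : G 0 = 0.
Proof. by rewrite /G set_itv1 Rintegral_set1. Qed.

(** The limit is two-sided: for negative [x] the interval is empty and [G x] is 0. *)
Let G_cvg0 : G x @[x --> 0] --> 0.
Proof. exact: (parameterized_integral_cvg_left ltr01 (h_integrable 0 1)). Qed.

Let G_ge0 x : 0 <= G x.
Proof. by apply: Rintegral_ge0 => y _; exact: op_norm_ge0. Qed.

Variables (T : \bar R) (e f : R -> 'cV[R]_n) (C : R).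
Hypothesis de : forall i,
  derivative_on T (fun s => e s i 0) (fun s => (A *m e s + f s) i 0).
Hypothesis e0 : e 0 = 0.
Hypothesis fC : forall s, 0 <= s -> (s%:E < T)%E -> `|f s| <= C.

Variable t : R.

Let is_derive_reflect (k : R -> R) dk (s : R) :
  is_derive (t - s) 1 k dk -> is_derive s 1 (fun u => k (t - u)) (- dk).
Proof.
move=> kd; rewrite -mulrN1; apply: is_derive1_comp.
rewrite -sub0r; exact: (is_deriveB (is_derive_cst t s 1) (is_derive_id s 1)).
Qed.

(** This curve runs from exp(tA) e(0) = 0 at s = 0 to e(t) at s = t. *)
Let v (s : R) := expm ((t - s) *: A) *m e s.

(** In the product rule the exponential contributes - exp((t - s) A) A e(s), which cancels the
    [A *m e s] part of e'; only the forcing term remains. *)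
Let is_derive_v i (s : R) : 0 < s -> (s%:E < T)%E ->
  is_derive s 1 (fun u => v u i 0) ((expm ((t - s) *: A) *m f s) i 0).
Proof.
move=> s0 sT.
have -> : (fun u => v u i 0) =
    \sum_j ((fun u => expm ((t - u) *: A) i j) * (fun u => e u j 0)).
  by apply/funext => u; rewrite /v mxE fct_sumE.
have dj j := (is_deriveM (is_derive_reflect (is_derive_expm A i j (t - s)))
    (derivative_on_is_derive (@de j) s0 sT)).
apply: (is_derive_eq (is_derive_sum dj)).
rewrite big_split /=.
transitivity ((expm ((t - s) *: A) *m (A *m e s + f s)
  - expm ((t - s) *: A) *m A *m e s) i 0).
  rewrite !mxE -sumrN; congr (_ + _); apply: eq_bigr => j _ //=.
  by rewrite /GRing.scale /= mulrN mulrC.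
by rewrite mulmxDr mulmxA addrAC subrr add0r.
Qed.

Let v_bound i (s : R) : 0 < s -> (s%:E < T)%E ->
  `|(expm ((t - s) *: A) *m f s) i 0| <= h (t - s) * C.
Proof.
move=> s0 sT; rewrite (le_trans (mx_norm_entry _ _ _))//.
rewrite (le_trans (op_normP _ _))// ler_wpM2l ?op_norm_ge0//.
exact: fC (ltW s0) sT.
Qed.

Lemma duhamel_bound : 0 <= t -> (t%:E < T)%E ->
  `|e t| <= C *
    \int[lebesgue_measure]_(tau in `[0, t]) op_norm (expm (tau *: A)).
Proof.
move=> + tT; rewrite -/(G t) le_eqVlt => /predU1P[<-|t0].
  by rewrite G0 mulr0 e0 normr0.
have T0 : (0 < T)%E by rewrite (lt_trans _ tT)// lte_fin.
have C0 : 0 <= C by rewrite (le_trans _ (fC (lexx _) T0)).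
(* The absolute value of an entry is handled by treating both signs, sg = 1 and sg = -1, at once. *)
suff bound sg i : `|sg| = 1 -> sg * e t i 0 <= C * G t.
  apply: mx_norm_le => [|i j]; first by rewrite mulr_ge0.
  rewrite ord1 ler_norml lerNl; apply/andP; split.
    by rewrite -mulN1r bound// normrN1.
  by rewrite -[leLHS]mul1r bound// normr1.
move=> sg1.
(* [psi] is nonincreasing on [0, t], because the derivative of the [v] term is at most C h(t - s) in
   absolute value while the [G] term contributes exactly - C h(t - s). The claim is psi(t) <=
   psi(0). *)
pose psi s := C * G (t - s) + sg * v s i 0.
have -> : sg * e t i 0 = psi t.
  by rewrite /psi /v subrr G0 mulr0 add0r expm0 mul1mx.
have -> : C * G t = psi 0.
  by rewrite /psi /v subr0 e0 mulmx0 mxE mulr0 addr0.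
have ltT s : s < t -> (s%:E < T)%E.
  by move=> st; rewrite (lt_trans _ tT)// lte_fin.
have dpsi (s : R) : s \in `]0, t[ -> is_derive s 1 psi
    (C * - h (t - s) + sg * (expm ((t - s) *: A) *m f s) i 0).
  rewrite in_itv => /andP[s0 st].
  have ts : 0 < t - s by rewrite subr_gt0.
  exact: (is_deriveD (is_deriveZ C (is_derive_reflect (is_derive_G ts)))
                     (is_deriveZ sg (is_derive_v i s0 (ltT s st)))).
have cv : v s i 0 @[s --> t] --> v t i 0.
  have [dv _] := is_derive_v i t0 tT.
  exact/differentiable_continuous/derivable1_diffP.
(* At 0 the exponential is continuous from both sides, but [e] only from the right. *)
have cv0 : v s i 0 @[s --> 0^'+] --> v 0 i 0.
  rewrite /v; under eq_cvg do rewrite mxE; rewrite mxE.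
  apply: cvg_big => [|j _]; first exact: add_continuous.
  apply: cvgM; last exact: (derivative_on_cvg_at_right0 (@de j) T0).
  apply: cvg_at_right_filter.
  have [dE _] := is_derive_reflect (is_derive_expm A i j (t - 0)).
  exact/differentiable_continuous/derivable1_diffP.
apply: (@ler0_derive1_le_cc _ psi 0 t); rewrite ?in_itv /= ?lexx ?ltW//.
- by move=> s /dpsi[].
- move=> s st; have ds := dpsi s st; rewrite derive1E derive_val.
  move: st; rewrite in_itv => /andP[s0 st].
  rewrite mulrN addrC subr_le0 mulrC (le_trans (ler_norm _))//.
  by rewrite normrM sg1 mulr1 mulrC v_bound// ltT.
- apply/(continuous_within_itvP _ t0); split.
  + move=> s /dpsi[ds _].
    exact/differentiable_continuous/derivable1_diffP.
  + apply: cvgD; apply: cvgMl_tmp => //.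
    have cG : {for (0 : R), continuous (fun u => G (t - u))}.
      have [dG _] : is_derive (0 : R) 1 (fun u => G (t - u)) (- h (t - 0)).
        by apply: is_derive_reflect; apply: is_derive_G; rewrite subr0.
      exact/differentiable_continuous/derivable1_diffP.
    exact: cvg_at_right_filter cG.
  (* At s = t the argument of [G] reaches 0, where [is_derive_G] does not apply; [G_cvg0] gives the
     limit. *)
  + apply: cvg_at_left_filter; apply: cvgD; apply: cvgMl_tmp => //.
    rewrite subrr G0; apply: (cvg_comp (fun s => t - s) G _ G_cvg0).
    have /(_ _ _) := cvgB (cvg_cst t) (@cvg_id _ (nbhs t)).
    by rewrite subrr; apply.
Qed.

End duhamel.

(** * The linearization remainder of the network *)

(** As kappa < 1 forces p >= 0 and r > 0, friction is p^2 / r. This is homogeneous of degree one, so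
    its tangent plane at (pb, rb) passes through the origin and the remainder is an exact square
    over r. *)
Lemma friction_remainder_bound (R : realType) (kappa p pb r rb : R) :
  0 < pb -> 0 < rb -> 0 <= kappa < 1 ->
  `|p - pb| <= kappa * pb -> `|r - rb| <= kappa * rb ->
  `|p * `|p| / r - pb * `|pb| / rb + pb * `|pb| / (rb * rb) * (r - rb)
    - 2 * (`|pb| / rb) * (p - pb)|
  <= 4 * (pb ^+ 2 / rb) * (kappa ^+ 2 / (1 - kappa)).
Proof.
move=> pb0 rb0 /andP[k0 k1] hp hr.
have k1' : 0 < 1 - kappa by rewrite subr_gt0.
have hr' : (1 - kappa) * rb <= r.
  by move: hr; rewrite ler_norml => /andP[+ _]; lra.
have r0 : 0 < r by apply: lt_le_trans hr'; rewrite mulr_gt0.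
have p0 : 0 <= p.
  have : (1 - kappa) * pb <= p.
    by move: hp; rewrite ler_norml => /andP[+ _]; lra.
  by apply: le_trans; rewrite mulr_ge0// ltW.
rewrite (ger0_norm p0) (gtr0_norm pb0).
set d := p - pb * r / rb.
have -> : p * p / r - pb * pb / rb + pb * pb / (rb * rb) * (r - rb)
    - 2 * (pb / rb) * (p - pb) = d ^+ 2 / r.
  by rewrite /d; field; rewrite !gt_eqF.
(* The flux and the density deviation each contribute kappa pb; squaring the 2 gives the constant
   4. *)
have hd : `|d| <= 2 * kappa * pb.
  have -> : d = (p - pb) - pb / rb * (r - rb).
    by rewrite /d; field; rewrite gt_eqF.
  rewrite (le_trans (ler_normB _ _))// normrM (gtr0_norm (divr_gt0 pb0 rb0)).
  have : pb / rb * `|r - rb| <= pb / rb * (kappa * rb).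
    by rewrite ler_wpM2l// divr_ge0// ltW.
  have -> : pb / rb * (kappa * rb) = kappa * pb by field; rewrite gt_eqF.
  lra.
rewrite normrM normrX normfV (gtr0_norm r0).
have -> : 4 * (pb ^+ 2 / rb) * (kappa ^+ 2 / (1 - kappa)) =
    (2 * kappa * pb) ^+ 2 / ((1 - kappa) * rb).
  by field; rewrite !gt_eqF.
apply: ler_pM; first exact: sqr_ge0.
- by rewrite invr_ge0 ltW.
- by rewrite lerXn2r// nnegrE (le_trans _ hd).
- by rewrite lef_pV2// posrE mulr_gt0.
Qed.

(** * Edgewise form of the remainder *)

Section network.
Context {R : realType} {Vs Vw E : nat}.
Variables (net : network Vs Vw E) (par : pipes R E) (mu : 'I_E -> R).
Hypothesis mu_ge1 : forall k, 1 <= mu k.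

Lemma head_withdrawal k : exists j, Defs.head net k = rshift Vs j.
Proof.
case: (split_ordP (Defs.head net k)) => i hi; last by exists i.
by have := head_not_supply net k i; rewrite hi eqxx.
Qed.

(** The positive part removes the tail entries, whose sign is -1 because [mu k] is positive, and
    leaves the incidence matrix of the heads. *)
Lemma Qlmx_entry k j : Qlmx net mu k j = (Defs.head net k == rshift Vs j)%:R.
Proof.
rewrite !mxE; case: eqP => [tj|_].
  rewrite sgrN gtr0_sg ?(lt_le_trans ltr01)// max_r ?lerN10// tj.
  by rewrite eq_sym (negPf (tail_neq_head net k)).
by rewrite eq_sym; case: eqP => _; rewrite ?sgr1 ?sgr0 ?maxxx// max_l.
Qed.

(** Each row of [Qlmx] has a single 1, so the matrix commutes with componentwise squaring; the
    denominator in [alphab] is then the square of the head density. *)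
Lemma mul_Qlmx k j (x : 'cV[R]_Vw) :
  Defs.head net k = rshift Vs j -> (Qlmx net mu *m x) k 0 = x j 0.
Proof.
move=> hk; rewrite mxE (bigD1 j)//= big1 => [|i ij].
  by rewrite Qlmx_entry hk eqxx mul1r addr0.
by rewrite Qlmx_entry hk (inj_eq (@rshift_inj _ _)) eq_sym (negPf ij) mul0r.
Qed.

Definition Kcoef k := fric par k / (2 * diam par k).

Lemma mul_Kmx (x : 'cV[R]_E) k : (Kmx par *m x) k 0 = Kcoef k * x k 0.
Proof. by rewrite /Kmx /vdiag mul_diag_mx !mxE. Qed.

Lemma mul_vdiag n (d x : 'cV[R]_n) k : (vdiag d *m x) k 0 = d k 0 * x k 0.
Proof. by rewrite /vdiag mul_diag_mx !mxE. Qed.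

Variables (s : 'cV[R]_Vs) (rhob : 'cV[R]_Vw) (phib : 'cV[R]_E).

Definition linearization_remainder (w rho : 'cV[R]_Vw) (phi : 'cV[R]_E) :=
  col_mx (nl_rho net par mu w phi) (nl_phi net par mu s rho phi)
  - (Abar net par mu rhob phib *m col_mx rho phi
     + lin_input net par mu s w rhob phib).

(** The density equation is already linear in the flux, and the pressure and supply terms are linear
    too, so only friction minus its tangent is left. *)
Lemma linearization_remainderE w rho phi :
  linearization_remainder w rho phi = col_mx 0
    (- (Kmx par *m (vdiv (vmul phi (vabs phi)) (Qlmx net mu *m rho)
                   - vdiv (vmul phib (vabs phib)) (Qlmx net mu *m rhob)))
     - alphab net par mu rhob phib *m (Qlmx net mu *m (rho - rhob))
     + betab net par mu rhob phib *m (phi - phib)).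
Proof.
rewrite /linearization_remainder /Abar /lin_input mul_block_col.
rewrite add_col_mx opp_col_mx add_col_mx.
congr col_mx.
  by rewrite /nl_rho mul0mx add0r mulmxBr !mulmxA subrr.
rewrite /nl_phi !mulmxBl !mulmxBr !mulmxDr scalerDr mulNmx -scalemxAl !mulmxA.
(* With the matrix products made opaque, the identity is a linear one that [ring] settles entry by
   entry. *)
move: (_ *: (_ *m rho)) (_ *: (_ *m s)) => x1 x2.
move: (Kmx par *m _) => x3; move: (Kmx par *m _) => x4.
move: (_ *m rho) (_ *m rhob) (_ *m phi) (_ *m phib) => x5 x6 x7 x8.
by apply/colP => k; rewrite !mxE; ring.
Qed.

(** A sum over the edges in place of a maximum: its terms are nonnegative, so it dominates each of
    them. *)
Definition remainder_coef : R :=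
  \sum_k 4 * (Kcoef k * (phib k 0 ^+ 2 / (Qlmx net mu *m rhob) k 0)).

Hypothesis phib_gt0 : forall k, 0 < phib k 0.
Hypothesis rhob_gt0 : forall j, 0 < rhob j 0.

Lemma Qlmx_gt0 k : 0 < (Qlmx net mu *m rhob) k 0.
Proof. by have [j hj] := head_withdrawal k; rewrite (mul_Qlmx _ hj). Qed.

Lemma Kcoef_ge0 k : 0 <= Kcoef k.
Proof. by rewrite divr_ge0 ?mulr_ge0 ?ltW ?fric_gt0 ?diam_gt0. Qed.

Lemma remainder_term_ge0 k :
  0 <= 4 * (Kcoef k * (phib k 0 ^+ 2 / (Qlmx net mu *m rhob) k 0)).
Proof.
by rewrite mulr_ge0// mulr_ge0 ?Kcoef_ge0// divr_ge0 ?sqr_ge0// ltW ?Qlmx_gt0.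
Qed.

Lemma remainder_coef_ge0 : 0 <= remainder_coef.
Proof. by apply: sumr_ge0 => k _; exact: remainder_term_ge0. Qed.

Lemma linearization_remainder_bound kappa w (rho : 'cV_Vw) (phi : 'cV_E) :
  0 <= kappa < 1 ->
  (forall j, `|rho j 0 - rhob j 0| <= kappa * rhob j 0) ->
  (forall k, `|phi k 0 - phib k 0| <= kappa * phib k 0) ->
  `|linearization_remainder w rho phi|
    <= remainder_coef * (kappa ^+ 2 / (1 - kappa)).
Proof.
move=> k01 hrho hphi; have /andP[k0 k1] := k01.
have q0 : 0 <= kappa ^+ 2 / (1 - kappa).
  by rewrite divr_ge0 ?sqr_ge0// subr_ge0 ltW.
rewrite linearization_remainderE.
apply: mx_norm_le => [|i z]; first by rewrite mulr_ge0 ?remainder_coef_ge0.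
rewrite {z}ord1; case: (split_ordP i) => k ->{i}.
  by rewrite col_mxEu mxE normr0 mulr_ge0 ?remainder_coef_ge0.
rewrite col_mxEd.
apply: (@le_trans _ _
    (4 * (Kcoef k * (phib k 0 ^+ 2 / (Qlmx net mu *m rhob) k 0))
    * (kappa ^+ 2 / (1 - kappa)))); last first.
  rewrite ler_wpM2r// /remainder_coef (bigD1 k)//= lerDl.
  by apply: sumr_ge0 => l _; exact: remainder_term_ge0.
have [j hj] := head_withdrawal k.
have entry (a b c : 'cV[R]_E) : (- a - b + c) k 0 = - a k 0 - b k 0 + c k 0.
  by rewrite !mxE.
rewrite entry /alphab /betab -!mulmxA -!scalemxAl.
have sub_entry m (a b : 'cV[R]_m) l : (a - b) l 0 = a l 0 - b l 0.
  by rewrite !mxE.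
have vdiv_entry m (a b : 'cV[R]_m) l : vdiv a b l 0 = a l 0 / b l 0.
  by rewrite !mxE.
have vmul_entry m (a b : 'cV[R]_m) l : vmul a b l 0 = a l 0 * b l 0.
  by rewrite !mxE.
have vabs_entry m (a : 'cV[R]_m) l : vabs a l 0 = `|a l 0| by rewrite !mxE.
have scale_entry m c (a : 'cV[R]_m) l : (c *: a) l 0 = c * a l 0.
  by rewrite !mxE.
rewrite scale_entry !mul_Kmx !mul_vdiag.
rewrite sub_entry !vdiv_entry !vmul_entry !vabs_entry !(mul_Qlmx _ hj).
rewrite vmul_entry !sub_entry.
have := friction_remainder_bound (phib_gt0 k) (rhob_gt0 j) k01
  (hphi k) (hrho j).
move=> /(ler_wpM2l (Kcoef_ge0 k)).
rewrite -{1}(ger0_norm (Kcoef_ge0 k)) -normrM => bound.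
have le_of_eq (x y : R) : x = y -> x <= y by move=> ->.
(* Friction enters the flux equation with a minus sign, so the entry is the opposite of the scalar
   remainder times [Kcoef k]. *)
rewrite -normrN; apply: le_trans (le_trans bound _).
  by apply: le_of_eq; congr (`|_|); ring.
by apply: le_of_eq; ring.
Qed.

End network.

Theorem theorem2 (R : realType) (Vs Vw E : nat)
    (net : network Vs Vw E) (par : pipes R E)
    (mub : 'I_E -> R) (sb : 'cV[R]_Vs)
    (rhob : 'cV[R]_Vw) (phib : 'cV[R]_E)
    (mub_ge1 : forall k, 1 <= mub k)
    (A_hurwitz : hurwitz (Abar net par mub rhob phib))
    (phib_gt0 : forall k, 0 < phib k 0)
    (rhob_gt0 : forall j, 0 < rhob j 0) :
  exists kmax a b : R,
    [/\ 0 < kmax < 1, 0 < a, 0 < b &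
      forall (T : \bar R) (kappa : R) (w : R -> 'cV[R]_Vw)
             (rho rhol : R -> 'cV[R]_Vw) (phi phil : R -> 'cV[R]_E),
        (0 < T)%E -> 0 <= kappa <= kmax ->
        nonlinear_solution net par mub sb w T rho phi ->
        linear_solution net par mub sb w rhob phib T rhol phil ->
        rhol 0 = rho 0 -> phil 0 = phi 0 ->
        steady_state net par mub sb (w 0) (rho 0) (phi 0) ->
        (forall t : R, 0 <= t -> (t%:E < T)%E ->
          (forall j, `|rho t j 0 - rhob j 0| <= kappa * rhob j 0) /\
          (forall k, `|phi t k 0 - phib k 0| <= kappa * phib k 0)) ->
        forall t : R, 0 <= t -> (t%:E < T)%E ->
          `|col_mx (rho t) (phi t) - col_mx (rhol t) (phil t)| <=
          (a * kappa ^+ 2 / (1 - kappa) ^+ 2 + b * kappa ^+ 2 / (1 - kappa)) *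
          \int[lebesgue_measure]_(tau in `[0, t])
             op_norm (expm (tau *: Abar net par mub rhob phib))].
Proof.
have c0 : 0 <= remainder_coef net par mub rhob phib.
  exact: remainder_coef_ge0.
(* Any bound below 1 would do for kappa. The added 1 turns the nonnegative coefficient into a
   positive [b]. *)
exists 2^-1, 1, (1 + remainder_coef net par mub rhob phib); split => //.
- by rewrite invr_gt0 ltr0n invf_lt1 ?ltr1n.
- by rewrite ltr_pwDl.
move=> T kappa w rho rhol phi phil T0 /andP[k0 kmax] [drho dphi] dlin rho0 phi0.
move=> _ near t t0 tT.
have k1 : kappa < 1 by rewrite (le_lt_trans kmax)// invf_lt1 ?ltr1n.
pose f s :=
  linearization_remainder net par mub sb rhob phib (w s) (rho s) (phi s).
pose e s := col_mx (rho s) (phi s) - col_mx (rhol s) (phil s).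
apply: (@duhamel_bound _ _ _ T e f) => //.
- move=> i.
  have dnl : derivative_on T (fun s => col_mx (rho s) (phi s) i 0)
      (fun s => col_mx (nl_rho net par mub (w s) (phi s))
                       (nl_phi net par mub sb (rho s) (phi s)) i 0).
    exact: derivative_on_col_mx_entry.
  have := derivative_onB dnl (derivative_on_entry (i := i) (j := 0) dlin).
  congr (derivative_on T _ _); apply/funext => s; first by rewrite !mxE.
  (* Adding and subtracting [Abar] applied to the nonlinear state splits e' into A e and the
     remainder; the inputs cancel. *)
  rewrite /e /f /linearization_remainder mulmxBr; set x := Abar _ _ _ _ _ *m _.
  set y := Abar _ _ _ _ _ *m _; rewrite !mxE; ring.
- by rewrite /e rho0 phi0 subrr.
- move=> s s0 sT; have [hrho hphi] := near s s0 sT.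
  have := @linearization_remainder_bound _ _ _ _ net par _ mub_ge1 sb _ _
    phib_gt0 rhob_gt0 kappa (w s) _ _ _ hrho hphi.
  rewrite k0 k1 => /(_ isT) /le_trans; apply.
  (* The target coefficient exceeds the remainder bound by kappa^2 / (1 - kappa)^2 + kappa^2 / (1 -
     kappa), which is nonnegative. *)
  have q0 d : 0 <= kappa ^+ 2 / (1 - kappa) ^+ d.
    by rewrite divr_ge0 ?exprn_ge0// subr_ge0 ltW.
  rewrite mul1r -[X in _ <= _ + X]mulrA mulrDl mul1r addrA lerDr.
  exact: addr_ge0 (q0 2) (q0 1).
Qed.
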